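(* Let $X,Y\subset\mathbb{R}^n$ be closed convex sets with $S:=X\cap Y\neq\varnothing$. Let $y\in Y$, $\alpha\in(0,1)$, and define $z:=\alpha y+(1-\alpha)P_Xy$. Then: (i) $z$ is centralized relative to $(X,Y)$. (ii) If $z$ is not strictly centralized relative to $(X,Y)$, then $z\in Y$. (iii) If $y\in P_Y(X)\setminus S$, then $z$ is strictly centralized relative to $(X,Y)$.
   Context: $\mathbb{R}^n$ carries the Euclidean inner product and norm. For a nonempty closed convex set $C$, $P_C$ is the metric projection onto $C$; $P_Y(X)=\{P_Yx : x\in X\}$. A point $z\in\mathbb{R}^n$ is centralized relative to $(X,Y)$ if $\langle z-P_Xz,\,z-P_Yz\rangle\le 0$, and strictly centralized relative to $(X,Y)$ if this inequality is strict. *)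

(* Defs.v *)
From HB Require Import structures.
From mathcomp Require Import all_boot all_order all_algebra.
From mathcomp Require Import all_classical all_reals all_analysis.

Set Implicit Arguments.
Unset Strict Implicit.
Unset Printing Implicit Defensive.
Import Order.TTheory GRing.Theory Num.Theory.
Import numFieldNormedType.Exports.
Local Open Scope classical_set_scope.
Local Open Scope ring_scope.

(* The library norm `|u| on 'rV[R]_n is the sup norm, hence the explicit
   Euclidean structure.  Both norms induce the same (product) topology, so
   the library's [closed] is the usual closedness in R^n. *)
Definition inner (R : realType) (n : nat) (u v : 'rV[R]_n) : R :=
  \sum_(i < n) u 0 i * v 0 i.

Definition enorm (R : realType) (n : nat) (u : 'rV[R]_n) : R :=
  Num.sqrt (inner u u).

Definition nearest_points (R : realType) (n : nat) (C : set 'rV[R]_n)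
    (x : 'rV[R]_n) : set 'rV[R]_n :=
  [set p | C p /\ forall q, C q -> enorm (x - p) <= enorm (x - q)].

(* [nearest_points C x] is a singleton when C is nonempty, closed and convex;
   the default value 0 is only used when there is no nearest point. *)
Definition metric_proj (R : realType) (n : nat) (C : set 'rV[R]_n) (x : 'rV[R]_n) :
    'rV[R]_n :=
  xget 0 (nearest_points C x).

Definition centralized (R : realType) (n : nat) (X Y : set 'rV[R]_n)
    (z : 'rV[R]_n) : Prop :=
  inner (z - metric_proj X z) (z - metric_proj Y z) <= 0.

Definition strictly_centralized (R : realType) (n : nat) (X Y : set 'rV[R]_n)
    (z : 'rV[R]_n) : Prop :=
  inner (z - metric_proj X z) (z - metric_proj Y z) < 0.

(* Main.v *)
(* Let p = P_X y and q = P_Y z.  Since z - p = alpha (y - p), the variational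
   inequality characterizing p also gives P_X z = p.  As
   z - p = alpha / (1 - alpha) (y - z) and <z - q, y - q> <= 0,
   <z - p, z - q> <= - alpha / (1 - alpha) |z - q|^2, which yields (i) and (ii).
   In (iii), if z were in Y, the variational inequality for y = P_Y x0 tested at
   z would give <x0 - y, p - y> <= 0, whereas the one for p tested at x0 gives
   <x0 - y, p - y> >= |p - y|^2; hence y = p would lie in X. *)
Require Import Defs.
From HB Require Import structures.
From mathcomp Require Import all_boot all_order all_algebra.
From mathcomp Require Import all_classical all_reals all_analysis.
From mathcomp Require Import ring lra.

Set Implicit Arguments.
Unset Strict Implicit.
Unset Printing Implicit Defensive.
Import Order.TTheory GRing.Theory Num.Theory.
Import numFieldNormedType.Exports.
Local Open Scope classical_set_scope.
Local Open Scope ring_scope.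

Lemma innerC (R : realType) (n : nat) (u v : 'rV[R]_n) : inner u v = inner v u.
Proof. by apply: eq_bigr => i _; rewrite mulrC. Qed.

Lemma innerDl (R : realType) (n : nat) (u v w : 'rV[R]_n) :
  inner (u + v) w = inner u w + inner v w.
Proof. by rewrite -big_split; apply: eq_bigr => i _; rewrite mxE mulrDl. Qed.

Lemma innerZl (R : realType) (n : nat) (a : R) (u v : 'rV[R]_n) :
  inner (a *: u) v = a * inner u v.
Proof. by rewrite mulr_sumr; apply: eq_bigr => i _; rewrite mxE mulrA. Qed.

Lemma innerNl (R : realType) (n : nat) (u v : 'rV[R]_n) :
  inner (- u) v = - inner u v.
Proof. by rewrite -scaleN1r innerZl mulN1r. Qed.

Lemma innerDr (R : realType) (n : nat) (u v w : 'rV[R]_n) :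
  inner w (u + v) = inner w u + inner w v.
Proof. by rewrite innerC innerDl !(innerC w). Qed.

Lemma innerZr (R : realType) (n : nat) (a : R) (u v : 'rV[R]_n) :
  inner v (a *: u) = a * inner v u.
Proof. by rewrite innerC innerZl innerC. Qed.

Lemma innerNr (R : realType) (n : nat) (u v : 'rV[R]_n) :
  inner v (- u) = - inner v u.
Proof. by rewrite innerC innerNl innerC. Qed.

Definition innerE := (innerDl, innerDr, innerNl, innerNr, innerZl, innerZr).

Lemma inner_ge0 (R : realType) (n : nat) (u : 'rV[R]_n) : 0 <= inner u u.
Proof. by apply: sumr_ge0 => i _; rewrite -expr2 sqr_ge0. Qed.

Lemma inner_le0 (R : realType) (n : nat) (u : 'rV[R]_n) :
  inner u u <= 0 -> u = 0.
Proof.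
move=> u_le0; have /eqP : inner u u = 0.
  by apply/eqP; rewrite eq_le u_le0 inner_ge0.
rewrite psumr_eq0 => [/allP u0|i _]; last by rewrite -expr2 sqr_ge0.
apply/rowP => i; rewrite mxE; apply/eqP.
by have := u0 i (mem_index_enum i); rewrite mulf_eq0 orbb.
Qed.

Lemma enorm_le (R : realType) (n : nat) (u v : 'rV[R]_n) :
  (enorm u <= enorm v) = (inner u u <= inner v v).
Proof. by rewrite ler_sqrt // inner_ge0. Qed.

Lemma coord_sqr_le (R : realType) (n : nat) (u : 'rV[R]_n) (i : 'I_n) :
  u 0 i ^+ 2 <= inner u u.
Proof.
rewrite /inner (bigD1 i) //= -expr2 lerDl.
by apply: sumr_ge0 => j _; rewrite -expr2 sqr_ge0.
Qed.

Lemma continuous_sqdist (R : realType) (n : nat) (x : 'rV[R]_n) :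
  continuous (fun q : 'rV[R]_n => inner (x - q) (x - q)).
Proof.
rewrite /inner; apply: continuous_big => [|i _ q]; first exact: add_continuous.
have c : continuous (fun p : 'rV[R]_n => (x - p) 0 i).
  rewrite (_ : (fun _ => _) = fun p : 'rV[R]_n => x 0 i - p 0 i).
    move=> p; apply: continuousB; first exact: cst_continuous.
    exact: coord_continuous.
  by apply/funext => p; rewrite !mxE.
exact: continuousM (c q) (c q).
Qed.

Lemma compact_sublevel (R : realType) (n : nat) (C : set 'rV[R]_n)
    (x : 'rV[R]_n) (r : R) :
  closed C -> compact (C `&` [set q | inner (x - q) (x - q) <= r]).
Proof.
move=> C_closed; apply: bounded_closed_compact.
  (* The bound is for the sup norm: each coordinate [t] of [x - q] satisfies [t ^+ 2 <= r], hence
     [|t| <= |r| + 1], which avoids a square root. *)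
  exists (`|x| + (`|r| + 1)); split; first exact: num_real.
  move=> M ltM q [_ /= qr]; apply: (le_trans _ (ltW ltM)).
  rewrite -[q](subKr x); apply: (le_trans (ler_normB _ _)); rewrite lerD2l.
  rewrite [leLHS]/Num.norm /= mx_normrE; apply: bigmax_le => [|[i j] _ /=].
    by have := normr_ge0 r; lra.
  rewrite ord1; have := coord_sqr_le (x - q) j => h.
  rewrite -real_normK ?num_real // in h.
  have := ler_norm r; have := normr_ge0 r; have := normr_ge0 ((x - q) 0 j).
  by nra.
apply: closedI => //.
apply: (preimage_closed _ (@closed_le _ r)) => q _.
exact: continuous_sqdist.
Qed.

(** [C] may be unbounded, so the squared distance is minimized over the compact part of [C] at least
    as close to [x] as a chosen point [c]; every other point of [C] is farther than [c], hence than
    the minimizer. *)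
Lemma nearest_points_neq0 (R : realType) (n : nat) (C : set 'rV[R]_n)
    (x : 'rV[R]_n) :
  closed C -> C !=set0 -> nearest_points C x !=set0.
Proof.
move=> C_closed [c Cc]; set r := inner (x - c) (x - c).
have [|p] := EVT_min_rV _ (@compact_sublevel R n C x r C_closed)
    (continuous_subspaceT (@continuous_sqdist R n x)).
  by exists c; split => /=.
rewrite inE => -[Cp /= pr] p_min; exists p; split => // q Cq.
rewrite enorm_le; have [qr|rq] := leP (inner (x - q) (x - q)) r.
  by apply: p_min; rewrite inE.
exact: le_trans pr (ltW rq).
Qed.

(* Comparing [p] with [p + t (q - p)] and letting [a := <x - p, q - p>],
   [b := |q - p|^2] gives [2 a <= t b]; the choice [t = a / (a + b)] refutes
   [0 < a]. *)
Lemma nearest_points_obtuse (R : realType) (n : nat) (C : set 'rV[R]_n)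
    (x p q : 'rV[R]_n) :
  @convex_set R 'rV[R]_n C -> nearest_points C x p -> C q ->
  inner (x - p) (q - p) <= 0.
Proof.
move=> C_convex [Cp p_min] Cq; rewrite leNgt; apply/negP.
set a := inner _ _ => a_gt0; pose b := inner (q - p) (q - p).
have b_ge0 : 0 <= b by exact: inner_ge0.
have ab_gt0 : 0 < a + b by lra.
pose t := a / (a + b).
have tE : t * (a + b) = a by rewrite divfK // gt_eqF.
have t_gt0 : 0 < t by exact: divr_gt0.
have t_le1 : t <= 1 by rewrite ler_pdivrMr // mul1r; lra.
have Ct : C (p + t *: (q - p)).
  have := C_convex q p (Itv01 (ltW t_gt0) t_le1).
  rewrite !inE => /(_ Cq Cp); congr C.
  by apply/rowP => i; rewrite !mxE /= /unstable.onem; ring.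
have := p_min _ Ct; rewrite enorm_le opprD addrA.
have -> : inner (x - p - t *: (q - p)) (x - p - t *: (q - p)) =
    inner (x - p) (x - p) - 2 * t * a + t ^+ 2 * b.
  rewrite /a /b; move: (x - p) (q - p) => u v.
  by rewrite !innerE (innerC v u); ring.
move=> le_t.
(* Cancelling [t] leaves [2 * a <= t * b], whereas [tE] gives [t * b = a - t * a < a]. *)
have : t * (2 * a) <= t * (t * b) by lra.
by rewrite ler_pM2l //; have := mulr_gt0 t_gt0 a_gt0; lra.
Qed.

Lemma metric_projP (R : realType) (n : nat) (C : set 'rV[R]_n)
    (x : 'rV[R]_n) :
  closed C -> @convex_set R 'rV[R]_n C -> C !=set0 ->
  C (metric_proj C x) /\
  forall q, C q -> inner (x - metric_proj C x) (q - metric_proj C x) <= 0.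
Proof.
move=> C_closed C_convex C0.
have near := xgetPex 0 (nearest_points_neq0 x C_closed C0).
by split; [exact: near.1|move=> q; exact: nearest_points_obtuse].
Qed.

(** If [r] is the projection, testing the inequality of [p] at [r] and that of [r] at [p] and adding
    gives [|r - p|^2 <= 0]. *)
Lemma metric_proj_eq (R : realType) (n : nat) (C : set 'rV[R]_n)
    (x p : 'rV[R]_n) :
  closed C -> @convex_set R 'rV[R]_n C -> C p ->
  (forall q, C q -> inner (x - p) (q - p) <= 0) -> metric_proj C x = p.
Proof.
move=> C_closed C_convex Cp p_obtuse.
have [|Cr /(_ p Cp)] := metric_projP x C_closed C_convex; first by exists p.
move: Cr; set r := metric_proj C x => /p_obtuse xp xr.
apply/eqP; rewrite -subr_eq0; apply/eqP/inner_le0.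
by move: xp xr; rewrite !innerE (innerC p r); lra.
Qed.

Theorem lemma1p3 (R : realType) (n : nat) (X Y : set 'rV[R]_n)
  (X_closed : closed X) (X_convex : @convex_set R 'rV[R]_n X)
  (Y_closed : closed Y) (Y_convex : @convex_set R 'rV[R]_n Y)
  (S_nonempty : X `&` Y !=set0)
  (y : 'rV[R]_n) (y_in_Y : Y y)
  (alpha : R) (alpha_gt0 : 0 < alpha) (alpha_lt1 : alpha < 1) :
  let S := X `&` Y in
  let z := alpha *: y + (1 - alpha) *: metric_proj X y in
  [/\ centralized X Y z,
      ~ strictly_centralized X Y z -> Y z
    & (metric_proj Y @` X `\` S) y -> strictly_centralized X Y z].
Proof.
move=> S z; case: S_nonempty => s [Xs Ys].
have [|Xp y_obtuse] := metric_projP y X_closed X_convex; first by exists s.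
have [|Yq z_obtuse] := metric_projP z Y_closed Y_convex; first by exists s.
set p := metric_proj X y in z Xp y_obtuse z_obtuse Yq *.
set q := metric_proj Y z in z_obtuse Yq *.
have zp : z - p = alpha *: (y - p).
  by apply/rowP => i; rewrite !mxE; ring.
have zy : z - y = (1 - alpha) *: (p - y).
  by apply/rowP => i; rewrite !mxE; ring.
have Pz : metric_proj X z = p.
  apply: metric_proj_eq => // x Xx; rewrite zp innerZl.
  by have := y_obtuse x Xx; nra.
(* Multiplying by [1 - alpha] avoids division, since [(1 - alpha)(z - p) = alpha (y - z)]; then
   [y - z] is split as [(y - q) - (z - q)]. *)
have le_key :
    (1 - alpha) * inner (z - p) (z - q) <= - alpha * inner (z - q) (z - q).
  have -> : (1 - alpha) * inner (z - p) (z - q) =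
      alpha * inner (y - z) (z - q).
    by rewrite zp -(opprB z y) zy !innerE; ring.
  have -> : inner (y - z) (z - q) =
      inner (z - q) (y - q) - inner (z - q) (z - q).
    by rewrite innerC -innerNr -innerDr opprB addrA subrK.
  by have := z_obtuse y y_in_Y; nra.
have zq_ge0 := inner_ge0 (z - q).
have central : centralized X Y z by rewrite /centralized Pz -/q; nra.
have inY : ~ strictly_centralized X Y z -> Y z.
  move=> /negP; rewrite /strictly_centralized Pz -/q -leNgt => ge0.
  (* A nonnegative left side in [le_key] forces [z = q], a point of [Y]. *)
  have /inner_le0/eqP : inner (z - q) (z - q) <= 0 by nra.
  by rewrite subr_eq0 => /eqP ->.
split=> // -[[x0 Xx0 x0y] notS]; apply: contrapT => /inY Yz.
have [|_ /(_ z Yz)] := metric_projP x0 Y_closed Y_convex; first by exists s.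
rewrite x0y zy innerZr => x0_obtuse.
apply: notS; split => //.
have /inner_le0/eqP : inner (y - p) (y - p) <= 0.
  have := y_obtuse x0 Xx0.
  (* The factor [1 - alpha > 0] is cancelled from [x0_obtuse]. Since [<x0 - y, p - y> = <x0 - p, p -
     y> + |p - y|^2] and [y_obtuse] makes the first summand nonnegative, [y = p] follows. *)
  have : inner (x0 - y) (p - y) <= 0 by nra.
  by rewrite !innerE !(innerC _ x0) (innerC p y); lra.
by rewrite subr_eq0 => /eqP ->.
Qed.
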